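(* Let $r\ge1$, $\mathbf n=(n_1,\dots,n_r)\in\mathbb N_0^r$, $\mathbf a,\mathbf b\in\mathbb R^{r+1}$, $\mathbf x\in\mathbb C^r$, such that no lower parameter of the ${}_3F_2$'s occurring below is a nonpositive integer and no denominator below vanishes. Then $$\begin{aligned}&E_0\;{}_rS_{\mathbf n}(\mathbf x;\mathbf a,\mathbf b)+E_1\;{}_rS_{\mathbf n}(\mathbf x;a_1+1,a_2,\dots,a_{r+1},b_1-1,b_2,\dots,b_{r+1})\\&\quad+E_2\;{}_rS_{\mathbf n}(\mathbf x;a_1+2,a_2,\dots,a_{r+1},b_1-2,b_2,\dots,b_{r+1})=0,\end{aligned}$$ where $$E_0=-\frac{b_1-1+\frac{x_1}{2}}{|\mathbf n^2|+|\mathbf a|-1},$$ $$\begin{aligned}E_1=&\;\frac{\big(2|\mathbf n^2|+2|\mathbf a|+1\big)\big(2|\mathbf n^2|+|\mathbf a^2|+|\mathbf b|-2+\frac{x_1}{2}\big)+n_1\big(n_1+2|\mathbf n^2|+|\mathbf a|+|\mathbf b|-1\big)}{\big(|\mathbf n^2|+|\mathbf a|-1\big)_2}\\&-\frac{\big(2|\mathbf n^2|+|\mathbf a|+|\mathbf b|-1\big)\big(|\mathbf n^2|+|\mathbf a^2|+\frac{x_1}{2}\big)}{\big(|\mathbf n^2|+|\mathbf a|-1\big)_2}-\frac{2|\mathbf n^2|+|\mathbf a^2|+|\mathbf b^2|-1}{|\mathbf n^2|+|\mathbf a|-1},\end{aligned}$$ $$E_2=-\frac{\big(|\mathbf n|+|\mathbf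 a|+1\big)\big(|\mathbf n|+|\mathbf b|-2\big)\big(a_1-\frac{x_1}{2}+1\big)}{\big(|\mathbf n^2|+|\mathbf a|-1\big)_3}.$$
   Context: Notation: $(c)_k=c(c+1)\cdots(c+k-1)$, $(c)_0=1$; ${}_3F_2\left(\begin{matrix}c_1,c_2,c_3\\ d_1,d_2\end{matrix}\Big|z\right)=\sum_{k\ge0}\frac{(c_1)_k(c_2)_k(c_3)_k}{(d_1)_k(d_2)_k}\frac{z^k}{k!}$ (a finite sum when $c_1=-n$, $n\in\mathbb N_0=\{0,1,\dots\}$). For $r\ge1$, $\mathbf n=(n_1,\dots,n_r)$, $\mathbf a=(a_1,\dots,a_{r+1})$, $\mathbf b=(b_1,\dots,b_{r+1})$: $|\mathbf n^j|=n_j+\cdots+n_r$ with $|\mathbf n^{r+1}|=0$, $|\mathbf a^j|=a_j+\cdots+a_{r+1}$, $|\mathbf b^j|=b_j+\cdots+b_{r+1}$, and $|\mathbf n|=|\mathbf n^1|$, $|\mathbf a|=|\mathbf a^1|$, $|\mathbf b|=|\mathbf b^1|$. For $\mathbf x=(x_1,\dots,x_r)$, $${}_rS_{\mathbf n}(\mathbf x;\mathbf a,\mathbf b)=\prod_{j=1}^r\left\{\Big(|\mathbf a^{j+1}|+\frac{x_j}{2}\Big)_{|\mathbf n^{j+1}|}\;{}_3F_2\left(\begin{matrix}-n_j,\;n_j+2|\mathbf n^{j+1}|+|\mathbf a^j|+|\mathbf b^j|-1,\;|\mathbf n^{j+1}|+|\mathbf a^{j+1}|+\frac{x_j}{2}\\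 2|\mathbf n^{j+1}|+|\mathbf a^{j+1}|+|\mathbf b^{j+1}|,\;|\mathbf n^{j+1}|+|\mathbf a^j|\end{matrix}\,\Big|\,1\right)\right\}.$$ *)

(* Defs.v *)
From HB Require Import structures.
From mathcomp Require Import all_boot all_order all_algebra.
From mathcomp Require Import all_classical all_reals all_analysis.
From mathcomp Require Import complex.

Set Implicit Arguments.
Unset Strict Implicit.
Unset Printing Implicit Defensive.

Import Order.TTheory GRing.Theory Num.Theory.
Import numFieldNormedType.Exports.

Local Open Scope ring_scope.
Local Open Scope complex_scope.

Definition pochhammer (K : pzSemiRingType) (c : K) (k : nat) : K :=
  \prod_(i < k) (c + i%:R).

Definition hyp3F2 (K : numFieldType) (c1 c2 c3 d1 d2 z : K) : K :=
  limn (series (fun k =>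
    (pochhammer c1 k * pochhammer c2 k * pochhammer c3 k)
      / (pochhammer d1 k * pochhammer d2 k) * (z ^+ k / k`!%:R))).

(* Indices start at 0, so that [tail v j] is |v^(j+1)| in the usual notation
   |v^j| = v_j + ... + v_m for v = (v_1, ..., v_m); it is 0 for j >= m. *)
Definition tail (V : nmodType) (m : nat) (v : 'I_m -> V) (j : nat) : V :=
  \sum_(i < m | (j <= i)%N) v i.

Definition add_first (V : nmodType) (m : nat) (v : 'I_m.+1 -> V) (c : V) :
    'I_m.+1 -> V :=
  fun i => if i == ord0 then v i + c else v i.

Section HypergeometricProduct.
Variables (R : realType) (r : nat).
Implicit Types (n : 'I_r -> nat) (a b : 'I_r.+1 -> R) (x : 'I_r -> R[i]).

Definition lower1 n a b (j : 'I_r) : R :=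
  2 * (tail n j.+1)%:R + tail a j.+1 + tail b j.+1.

Definition lower2 n a (j : 'I_r) : R := (tail n j.+1)%:R + tail a j.

Definition nonpos_integer (c : R) : bool := (c \is a Num.int) && (c <= 0).

Definition lower_params_ok n a b : Prop :=
  forall j : 'I_r,
    ~~ nonpos_integer (lower1 n a b j) /\ ~~ nonpos_integer (lower2 n a j).

Definition rS n x a b : R[i] :=
  \prod_(j < r)
    (pochhammer ((tail a j.+1)%:C + x j / 2) (tail n j.+1)
     * hyp3F2 (- (n j)%:R)
         ((n j)%:R + 2 * (tail n j.+1)%:R + (tail a j)%:C + (tail b j)%:C - 1)
         ((tail n j.+1)%:R + (tail a j.+1)%:C + x j / 2)
         (lower1 n a b j)%:C
         (lower2 n a j)%:C
         1).

(* (|n^2| + |a| - 1)_k: the denominators of E0, E1, E2 are the cases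
   k = 1, 2, 3. *)
Definition denom n a (k : nat) : R :=
  pochhammer ((tail n 1)%:R + tail a 0 - 1) k.

Definition E0 (hr : (0 < r)%N) n x a b : R[i] :=
  let x1 := x (Ordinal hr) in
  - (((b ord0)%:C - 1 + x1 / 2) / (denom n a 1)%:C).

Definition E1 (hr : (0 < r)%N) n x a b : R[i] :=
  let x1 := x (Ordinal hr) in
  let n1 : R[i] := (n (Ordinal hr))%:R in
  let N2 : R[i] := (tail n 1)%:R in
  let A := (tail a 0)%:C in
  let A2 := (tail a 1)%:C in
  let B := (tail b 0)%:C in
  let B2 := (tail b 1)%:C in
  ((2 * N2 + 2 * A + 1) * (2 * N2 + A2 + B - 2 + x1 / 2)
     + n1 * (n1 + 2 * N2 + A + B - 1)) / (denom n a 2)%:C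
  - (2 * N2 + A + B - 1) * (N2 + A2 + x1 / 2) / (denom n a 2)%:C
  - (2 * N2 + A2 + B2 - 1) / (denom n a 1)%:C.

Definition E2 (hr : (0 < r)%N) n x a b : R[i] :=
  let x1 := x (Ordinal hr) in
  let N : R[i] := (tail n 0)%:R in
  let A := (tail a 0)%:C in
  let B := (tail b 0)%:C in
  - ((N + A + 1) * (N + B - 2) * ((a ord0)%:C - x1 / 2 + 1)
       / (denom n a 3)%:C).

End HypergeometricProduct.

(* Main.v *)
(** Only the first factor of the product changes, and in it only the lower
    parameter [e = |n^2| + |a|], which becomes [e + 1] and [e + 2].  The claim
    is thus a three-term contiguous relation for a terminating 3F2 at 1, and
    its summand telescopes (Gosper): with [u k] the term of parameters [d],
    [e + 2] up to a constant, it is [G (k + 1) - G k] for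
    [G k = - u k * k * (d + k - 1) * (e + k + 1)]. *)

Require Import Defs.
From mathcomp Require Import all_boot all_order all_algebra.
From mathcomp Require Import all_classical all_reals all_analysis.
From mathcomp Require Import complex.
From mathcomp Require Import ring.

Set Implicit Arguments.
Unset Strict Implicit.
Unset Printing Implicit Defensive.

Import Order.TTheory GRing.Theory Num.Theory.
Import numFieldNormedType.Exports.

Local Open Scope ring_scope.
Local Open Scope complex_scope.

Section Pochhammer.
Variable K : numFieldType.
Implicit Types c : K.

Lemma pochhammer0 c : pochhammer c 0 = 1.
Proof. by rewrite /pochhammer big_ord0. Qed.

Lemma pochhammerS c k : pochhammer c k.+1 = pochhammer c k * (c + k%:R).
Proof. by rewrite /pochhammer big_ord_recr. Qed.

Lemma pochhammerSl c k : pochhammer c k.+1 = c * pochhammer (c + 1) k.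
Proof.
rewrite /pochhammer big_ord_recl addr0; congr (_ * _).
by apply: eq_bigr => i _; rewrite -addrA -natr1 [1 + _]addrC.
Qed.

Lemma pochhammer_neq0 c k :
  (forall i : nat, c + i%:R != 0) -> pochhammer c k != 0.
Proof. by move=> hc; apply/prodf_neq0 => i _. Qed.

Lemma pochhammer_oppn_eq0 (n k : nat) :
  (n < k)%N -> pochhammer (- n%:R : K) k = 0.
Proof.
by move=> ltnk; apply/eqP/prodf_eq0; exists (Ordinal ltnk); rewrite //= addNr.
Qed.

End Pochhammer.

Section Contiguous.
Variable K : numFieldType.
Implicit Types c d e : K.

Definition hyp_term c1 c2 c3 d e (k : nat) : K :=
  pochhammer c1 k * pochhammer c2 k * pochhammer c3 k
    / (pochhammer d k * pochhammer e k) / k`!%:R.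

Definition hyp_sum m c1 c2 c3 d e : K :=
  \sum_(k < m) hyp_term c1 c2 c3 d e k.

(** [hyp3F2] is a limit of partial sums; since [(-n)_k] vanishes for [k > n], these are constant
    from index [n.+1] on. *)
Lemma hyp3F2_terminating (n : nat) c2 c3 d e :
  hyp3F2 (- n%:R) c2 c3 d e 1 = hyp_sum n.+1 (- n%:R) c2 c3 d e.
Proof.
apply: (@lim_near_cst K); first exact: norm_hausdorff.
near=> m.
have ltnm : (n.+1 <= m)%N by near: m; exact: nbhs_infty_ge.
rewrite /series /= (big_cat_nat (n := n.+1)) //=.
rewrite [X in _ + X]big_nat_cond [X in _ + X]big1 ?addr0.
  rewrite big_mkord; apply: eq_bigr => k _.
  by rewrite /hyp_term expr1n mul1r.
by move=> k /andP[/andP[ltnk _] _]; rewrite pochhammer_oppn_eq0 // !mul0r.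
Unshelve. all: by end_near. Qed.

(** The coefficients are symmetric in [c1], [c2], [c3]; [c1] is singled out only as the parameter
    that makes the sum terminate. *)
Lemma hyp_sum_contiguous c1 c2 c3 d e (m : nat) :
    (forall k : nat, d + k%:R != 0) -> (forall k : nat, e + k%:R != 0) ->
    pochhammer c1 m = 0 ->
  (d + e - c1 - c2 - c3) * hyp_sum m c1 c2 c3 d e
  + (((2 * e + 1) * (c1 + c2 + c3 - e - 1)
      - c1 * c2 - c1 * c3 - c2 * c3) / e - (d - 1))
    * hyp_sum m c1 c2 c3 d (e + 1)
  + (e + 1 - c1) * (e + 1 - c2) * (e + 1 - c3) / (e * (e + 1))
    * hyp_sum m c1 c2 c3 d (e + 2) = 0.
Proof.
move=> hd he hc1.
have e0 : e != 0 by have := he 0%N; rewrite addr0.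
have e1 : e + 1 != 0 by exact: he 1%N.
(* [(e)_(k+2)] is a common denominator for the terms at [e], [e + 1] and [e + 2]; the last of these
   is [e * (e + 1) * u k]. *)
pose u k := pochhammer c1 k * pochhammer c2 k * pochhammer c3 k
  / (pochhammer d k * pochhammer e k.+2 * k`!%:R).
pose G k := - (u k * k%:R * (d + k%:R - 1) * (e + k%:R + 1)).
rewrite /hyp_sum !mulr_sumr -!big_split /=.
(* Both boundary terms vanish: [G m] because [(c1)_m = 0], [G 0] because of its factor [k]. *)
transitivity (G m - G 0%N); last first.
  by rewrite /G /u hc1 !(mul0r, mulr0, oppr0) addr0.
rewrite -telescope_sumr // big_mkord; apply: eq_bigr => -[k _] _ /=.
have dk := hd k; have ek := he k.
have k1 : k%:R + 1 != 0 :> K by rewrite natr1 pnatr_eq0.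
have kf : k`!%:R != 0 :> K by rewrite pnatr_eq0 -lt0n fact_gt0.
have pd : pochhammer d k != 0 by exact: pochhammer_neq0.
have pe : pochhammer e k != 0 by exact: pochhammer_neq0.
(* Splitting [(e)_(k+1)] and [(e)_(k+2)] at either end expresses the shifted symbols through
   [(e)_k], so that [field] sees a single atom. *)
have pe1 : pochhammer (e + 1) k = pochhammer e k * (e + k%:R) / e.
  by rewrite -pochhammerS pochhammerSl mulrC mulKf.
have pe2 : pochhammer (e + 2) k
    = pochhammer e k * (e + k%:R) * (e + k%:R + 1) / (e * (e + 1)).
  rewrite -(addrA e k%:R) natr1 -!pochhammerS 2!pochhammerSl -addrA.
  by rewrite mulrA mulrC mulKf // mulf_neq0.
rewrite /G /u /hyp_term pe1 pe2 !pochhammerS factS natrM -!natr1.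
field.
by rewrite e1 kf pe e0 ek pd k1 dk !natr1 !he.
Qed.

End Contiguous.

Lemma nonpos_integerN_neq0 (R : realType) (c : R) :
  ~~ nonpos_integer c -> forall k : nat, c%:C + k%:R != 0.
Proof.
move=> hc k; rewrite -(rmorph_nat (real_complex R)) -rmorphD /= fmorph_eq0.
apply: contra hc; rewrite addr_eq0 => /eqP ->.
by rewrite /nonpos_integer rpredN rpred_nat oppr_le0 ler0n.
Qed.

Section Tail.
Variables (V : nmodType) (m : nat).

Lemma tail0 (v : 'I_m.+1 -> V) : tail v 0 = v ord0 + tail v 1.
Proof.
rewrite /tail (bigD1 ord0) //=; congr (_ + _); apply: eq_bigl => i.
by rewrite lt0n.
Qed.

Lemma tail_add_first0 (v : 'I_m.+1 -> V) c :
  tail (add_first v c) 0 = tail v 0 + c.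
Proof.
rewrite /tail (bigD1 ord0) //= [in RHS](bigD1 ord0) //= /add_first eqxx.
rewrite addrAC; congr (_ + _ + _).
by apply: eq_bigr => i /negPf ->.
Qed.

Lemma tail_add_firstS (v : 'I_m.+1 -> V) c j :
  tail (add_first v c) j.+1 = tail v j.+1.
Proof. by apply: eq_bigr => -[[|i] lti]. Qed.

End Tail.

Section FirstFactor.
Variables (R : realType) (r : nat).
Implicit Types (n : 'I_r.+1 -> nat) (a b : 'I_r.+2 -> R) (x : 'I_r.+1 -> R[i]).

Definition rS_factor n x a b (j : 'I_r.+1) : R[i] :=
  pochhammer ((tail a j.+1)%:C + x j / 2) (tail n j.+1)
  * hyp3F2 (- (n j)%:R)
      ((n j)%:R + 2 * (tail n j.+1)%:R + (tail a j)%:C + (tail b j)%:C - 1)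
      ((tail n j.+1)%:R + (tail a j.+1)%:C + x j / 2)
      (lower1 n a b j)%:C (lower2 n a j)%:C 1.

(** The opposite shifts of [a_1] and [b_1] cancel in [|a| + |b|], and no later tail sees them. The
    cases [s = 0, 1, 2] give the three products of the theorem with common outer factors. *)
Lemma rS_add_first n x a b s :
  rS n x (add_first a s) (add_first b (- s))
  = pochhammer ((tail a 1)%:C + x ord0 / 2) (tail n 1)
    * hyp_sum (n ord0).+1 (- (n ord0)%:R)
      ((n ord0)%:R + 2 * (tail n 1)%:R + (tail a 0)%:C + (tail b 0)%:C - 1)
      ((tail n 1)%:R + (tail a 1)%:C + x ord0 / 2)
      (lower1 n a b ord0)%:C ((lower2 n a ord0)%:C + s%:C)
    * \prod_(j < r) rS_factor n x a b (lift ord0 j).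
Proof.
rewrite [LHS]big_ord_recl.
apply: (congr2 *%R); last first.
  apply: eq_bigr => j _.
  by rewrite /rS_factor /lower1 /lower2 !tail_add_firstS.
have shift_sum X u v : X + (u + s)%:C + (v - s)%:C = X + u%:C + v%:C :> R[i].
  by rewrite rmorphD rmorphB /=; ring.
rewrite hyp3F2_terminating /lower1 /lower2 !tail_add_firstS !tail_add_first0.
by rewrite shift_sum addrA [in LHS](rmorphD _ _ s).
Qed.

End FirstFactor.

Theorem theorem5p17 (R : realType) (r : nat) (hr : (1 <= r)%N)
    (n : 'I_r -> nat) (a b : 'I_r.+1 -> R) (x : 'I_r -> R[i])
    (hlow0 : lower_params_ok n a b)
    (hlow1 : lower_params_ok n (add_first a 1) (add_first b (-1)))
    (hlow2 : lower_params_ok n (add_first a 2) (add_first b (-2)))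
    (hden1 : denom n a 1 <> 0)
    (hden2 : denom n a 2 <> 0)
    (hden3 : denom n a 3 <> 0) :
  E0 hr n x a b * rS n x a b
  + E1 hr n x a b * rS n x (add_first a 1) (add_first b (-1))
  + E2 hr n x a b * rS n x (add_first a 2) (add_first b (-2)) = 0.
Proof.
move: hr n a b x hlow0 hlow1 hlow2 hden1 hden2 hden3.
case: r => // r' hr' n a b x hlow0 _ _ /eqP hden1 _ _.
(* The unshifted product is put in the form [s = 0], so that one lemma rewrites all three. *)
have -> : rS n x a b = rS n x (add_first a 0) (add_first b (- 0)).
  by congr rS; apply/funext => i; rewrite /add_first ?oppr0 addr0 if_same.
rewrite !rS_add_first.
have [/nonpos_integerN_neq0 hd /nonpos_integerN_neq0 he] := hlow0 ord0.
have := hyp_sum_contiguous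
  ((n ord0)%:R + 2 * (tail n 1)%:R + (tail a 0)%:C + (tail b 0)%:C - 1)
  ((tail n 1)%:R + (tail a 1)%:C + x ord0 / 2) hd he
  (pochhammer_oppn_eq0 _ (ltnSn (n ord0))).
(* The last argument is left out: [F] is a function of the second lower parameter. *)
move: (hyp_sum _ _ _ _ _) => F.
move: (\prod_(j < r') _) => P.
move: (pochhammer ((tail a 1)%:C + x ord0 / 2) _) => Q.
rewrite (rmorph0 (real_complex R)) (rmorph1 (real_complex R)).
rewrite (rmorph_nat (real_complex R) 2) addr0 => contig.
have ord0E : Ordinal hr' = ord0 by exact: val_inj.
have e0 := he 0%N; have e1 := he 1%N; rewrite addr0 in e0.
(* With [e = |n^2| + |a|], the denominators of [E0], [E1], [E2] are products of [e - 1], [e] and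
   [e + 1]; the last two are nonzero by [he]. *)
have em1 : (lower2 n a ord0)%:C - 1 != 0.
  move: hden1; rewrite /denom pochhammerS pochhammer0 mul1r addr0.
  by rewrite -(fmorph_eq0 (real_complex R)) rmorphB rmorph1.
have denomE k : (denom n a k)%:C = pochhammer ((lower2 n a ord0)%:C - 1) k.
  rewrite /denom /pochhammer rmorph_prod; apply: eq_bigr => i _.
  by rewrite rmorphD rmorphB rmorph1 rmorph_nat.
have tail_nE : (tail n 0)%:R = (n ord0)%:R + (tail n 1)%:R :> R[i].
  by rewrite tail0 -natrD.
have lower1E : (lower1 n a b ord0)%:C
  = 2 * (tail n 1)%:R + (tail a 1)%:C + (tail b 1)%:C.
  by rewrite /lower1 !rmorphD rmorphM !rmorph_nat.
have lower2E : (lower2 n a ord0)%:C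
  = (tail n 1)%:R + (a ord0)%:C + (tail a 1)%:C.
  by rewrite /lower2 tail0 !rmorphD rmorph_nat addrA.
(* Each of [E0], [E1], [E2] is the matching contiguity coefficient divided by [e - 1], so the claim
   is [contig] times [Q * P / (e - 1)]. *)
rewrite -[RHS](mulr0 (Q * P / ((lower2 n a ord0)%:C - 1))) -[in RHS]contig.
rewrite /E0 /E1 /E2 ord0E !denomE !pochhammerS !pochhammer0 !addr0.
rewrite lower1E lower2E tail_nE (tail0 a) (tail0 b) !rmorphD /=.
rewrite lower2E in e0 e1 em1.
(* The values of [F] at [e], [e + 1], [e + 2] become free variables, leaving an identity of rational
   functions. *)
do 3! move: (F _) => ?.
by field; rewrite e1 e0 em1.
Qed.
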